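(* There is a forgetful functor $U \colon \mathrm{PROP} \to \mathrm{Set}^{\mathbb{N}\times\mathbb{N}}$ sending any prop to its underlying signature and any morphism of props to its underlying morphism of signatures. This functor is monadic: that is, it has a left adjoint $F \colon \mathrm{Set}^{\mathbb{N}\times\mathbb{N}} \to \mathrm{PROP}$, and the category of algebras of the monad $UF$ is equivalent, via the canonical comparison functor, to the category $\mathrm{PROP}$.
   Context: A prop is a strict symmetric monoidal category having the natural numbers as objects, with the tensor product of objects given by addition. A morphism of props is a strict symmetric monoidal functor that is the identity on objects. $\mathrm{PROP}$ is the category of props and morphisms of props. The category of signatures is the functor category $\mathrm{Set}^{\mathbb{N}\times\mathbb{N}}$, where $\mathbb{N}\times\mathbb{N}$ is regarded as a discrete category. The underlying signature of a prop $T$ is the family of homsets $(m,n) \mapsto T(m,n)$, $m,n \in \mathbb{N}$. *)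

(* Defs.v *)
From mathcomp Require Import all_boot.
From Stdlib Require Import FunctionalExtensionality ProofIrrelevance.

Set Implicit Arguments.
Unset Strict Implicit.
Unset Printing Implicit Defensive.

(* One fixed universe of "sets": naming it makes the homsets of props and the
   values of signatures range over the same universe. *)
Definition Sets := Type.

(* [mcomp g f] is "g after f". *)
Record Category := {
  Ob :> Type;
  Hom : Ob -> Ob -> Type;
  idm : forall x, Hom x x;
  mcomp : forall x y z, Hom y z -> Hom x y -> Hom x z;
  mcomp1m : forall x y (f : Hom x y), mcomp (idm y) f = f;
  mcompm1 : forall x y (f : Hom x y), mcomp f (idm x) = f;
  mcompA : forall x y z w (h : Hom z w) (g : Hom y z) (f : Hom x y),
    mcomp h (mcomp g f) = mcomp (mcomp h g) f
}.
Arguments Hom {c} _ _.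
Arguments idm {c} x.
Arguments mcomp {c x y z} _ _.

Notation "g ∘ f" := (mcomp g f) (at level 40, left associativity).

Definition is_iso (C : Category) (x y : C) (f : Hom x y) : Prop :=
  exists g : Hom y x, g ∘ f = idm x /\ f ∘ g = idm y.

Record Functor (C D : Category) := {
  fobj :> C -> D;
  fmap : forall x y : C, Hom x y -> Hom (fobj x) (fobj y);
  fmap1 : forall x : C, fmap (idm x) = idm (fobj x);
  fmapM : forall (x y z : C) (g : Hom y z) (f : Hom x y),
    fmap (g ∘ f) = fmap g ∘ fmap f
}.
Arguments fmap {C D} f0 {x y} _.

Record NatTrans (C D : Category) (F G : Functor C D) := {
  component :> forall x : C, Hom (F x) (G x);
  naturality : forall (x y : C) (f : Hom x y),
    component y ∘ fmap F f = fmap G f ∘ component x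
}.

Definition id_functor (C : Category) : Functor C C :=
  {| fobj := fun x => x; fmap := fun _ _ f => f;
     fmap1 := fun _ => erefl; fmapM := fun _ _ _ _ _ => erefl |}.

Section CompFunctor.
Variables (C D E : Category) (G : Functor D E) (F : Functor C D).

Lemma comp_fmap1 (x : C) : fmap G (fmap F (idm x)) = idm (G (F x)).
Proof. by rewrite !fmap1. Qed.

Lemma comp_fmapM (x y z : C) (g : Hom y z) (f : Hom x y) :
  fmap G (fmap F (g ∘ f)) = fmap G (fmap F g) ∘ fmap G (fmap F f).
Proof. by rewrite !fmapM. Qed.

Definition comp_functor : Functor C E :=
  {| fobj := fun x => G (F x); fmap := fun _ _ f => fmap G (fmap F f);
     fmap1 := comp_fmap1; fmapM := comp_fmapM |}.
End CompFunctor.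

Definition is_equivalence (C D : Category) (K : Functor C D) : Prop :=
  exists (G : Functor D C)
         (a : NatTrans (id_functor C) (comp_functor G K))
         (b : NatTrans (comp_functor K G) (id_functor D)),
    (forall x : C, is_iso (a x)) /\ (forall y : D, is_iso (b y)).

Lemma NatTrans_eq (C D : Category) (F G : Functor C D) (a b : NatTrans F G) :
  (forall x, a x = b x) -> a = b.
Proof.
case: a b => [a na] [b nb] /= ab.
have eab : a = b by apply: functional_extensionality_dep.
by case: _ / eab nb => nb; congr Build_NatTrans; apply: proof_irrelevance.
Qed.

Section FunctorCategory.
Variables C D : Category.

Lemma id_naturality (F : Functor C D) (x y : C) (f : Hom x y) :
  idm (F y) ∘ fmap F f = fmap F f ∘ idm (F x).
Proof. by rewrite mcomp1m mcompm1. Qed.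

Definition id_nat (F : Functor C D) : NatTrans F F :=
  {| component := fun x => idm (F x); naturality := @id_naturality F |}.

Lemma comp_naturality (F G H : Functor C D)
    (b : NatTrans G H) (a : NatTrans F G) (x y : C) (f : Hom x y) :
  (b y ∘ a y) ∘ fmap F f = fmap H f ∘ (b x ∘ a x).
Proof. by rewrite -mcompA naturality mcompA naturality mcompA. Qed.

Definition comp_nat (F G H : Functor C D) (b : NatTrans G H) (a : NatTrans F G) :
    NatTrans F H :=
  {| component := fun x => b x ∘ a x; naturality := @comp_naturality F G H b a |}.

Lemma comp1_nat (F G : Functor C D) (a : NatTrans F G) :
  comp_nat (id_nat G) a = a.
Proof. by apply: NatTrans_eq => x; apply: mcomp1m. Qed.

Lemma comp_nat1 (F G : Functor C D) (a : NatTrans F G) :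
  comp_nat a (id_nat F) = a.
Proof. by apply: NatTrans_eq => x; apply: mcompm1. Qed.

Lemma comp_natA (F G H K : Functor C D)
    (c : NatTrans H K) (b : NatTrans G H) (a : NatTrans F G) :
  comp_nat c (comp_nat b a) = comp_nat (comp_nat c b) a.
Proof. by apply: NatTrans_eq => x; apply: mcompA. Qed.

Definition FunctorCat : Category :=
  {| Ob := Functor C D; Hom := @NatTrans C D; idm := id_nat; mcomp := comp_nat;
     mcomp1m := comp1_nat; mcompm1 := comp_nat1; mcompA := comp_natA |}.
End FunctorCategory.

Definition SetCat : Category :=
  {| Ob := Sets; Hom := fun A B => A -> B;
     idm := fun _ a => a; mcomp := fun _ _ _ g f a => g (f a);
     mcomp1m := fun _ _ _ => erefl; mcompm1 := fun _ _ _ => erefl;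
     mcompA := fun _ _ _ _ _ _ _ => erefl |}.

Section DiscreteCategory.
Variable T : Type.

Lemma discrete_comp1 (x y : T) (f : x = y) : etrans f erefl = f.
Proof. by case: _ / f. Qed.

Lemma discrete_1comp (x y : T) (f : x = y) : etrans erefl f = f.
Proof. by case: _ / f. Qed.

Lemma discrete_compA (x y z w : T) (h : z = w) (g : y = z) (f : x = y) :
  etrans (etrans f g) h = etrans f (etrans g h).
Proof. by case: _ / h; case: _ / g. Qed.

Definition Discrete : Category :=
  {| Ob := T; Hom := fun x y => x = y;
     idm := fun x => erefl x; mcomp := fun _ _ _ g f => etrans f g;
     mcomp1m := discrete_comp1; mcompm1 := discrete_1comp;
     mcompA := discrete_compA |}.
End DiscreteCategory.

(* [Adjunction F U]: F is left adjoint to U. *)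
Record Adjunction (C D : Category) (F : Functor C D) (U : Functor D C) := {
  adj_unit : NatTrans (id_functor C) (comp_functor U F);
  adj_counit : NatTrans (comp_functor F U) (id_functor D);
  triangleF : forall x : C, adj_counit (F x) ∘ fmap F (adj_unit x) = idm (F x);
  triangleU : forall y : D, fmap U (adj_counit y) ∘ adj_unit (U y) = idm (U y)
}.

Record Monad (C : Category) := {
  mfun :> Functor C C;
  eta : NatTrans (id_functor C) mfun;
  mu : NatTrans (comp_functor mfun mfun) mfun;
  mu_etal : forall x : C, mu x ∘ eta (mfun x) = idm (mfun x);
  mu_etar : forall x : C, mu x ∘ fmap mfun (eta x) = idm (mfun x);
  muA : forall x : C, mu x ∘ fmap mfun (mu x) = mu x ∘ mu (mfun x)
}.

Section EilenbergMoore.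
Variables (C : Category) (T : Monad C).

Record Algebra := {
  carrier :> C;
  action : Hom (T carrier) carrier;
  action_eta : action ∘ eta T carrier = idm carrier;
  action_mu : action ∘ mu T carrier = action ∘ fmap T action
}.

Record AlgebraHom (A B : Algebra) := {
  alg_mor :> Hom (carrier A) (carrier B);
  alg_morP : alg_mor ∘ action A = action B ∘ fmap T alg_mor
}.

Lemma AlgebraHom_eq (A B : Algebra) (f g : AlgebraHom A B) :
  alg_mor f = alg_mor g -> f = g.
Proof.
case: f g => [f Pf] [g Pg] /= fg; case: _ / fg Pg => Pg.
by congr Build_AlgebraHom; apply: proof_irrelevance.
Qed.

Lemma id_algP (A : Algebra) :
  idm (carrier A) ∘ action A = action A ∘ fmap T (idm (carrier A)).
Proof. by rewrite fmap1 mcomp1m mcompm1. Qed.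

Definition id_alg (A : Algebra) : AlgebraHom A A :=
  {| alg_mor := idm (carrier A); alg_morP := id_algP A |}.

Lemma comp_algP (A B D : Algebra) (g : AlgebraHom B D) (f : AlgebraHom A B) :
  (alg_mor g ∘ alg_mor f) ∘ action A
  = action D ∘ fmap T (alg_mor g ∘ alg_mor f).
Proof. by rewrite fmapM -mcompA alg_morP mcompA alg_morP mcompA. Qed.

Definition comp_alg (A B D : Algebra) (g : AlgebraHom B D) (f : AlgebraHom A B) :
    AlgebraHom A D :=
  {| alg_mor := alg_mor g ∘ alg_mor f; alg_morP := comp_algP g f |}.

Lemma comp1_alg (A B : Algebra) (f : AlgebraHom A B) :
  comp_alg (id_alg B) f = f.
Proof. by apply: AlgebraHom_eq; apply: mcomp1m. Qed.

Lemma comp_alg1 (A B : Algebra) (f : AlgebraHom A B) :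
  comp_alg f (id_alg A) = f.
Proof. by apply: AlgebraHom_eq; apply: mcompm1. Qed.

Lemma comp_algA (A B D E : Algebra)
    (h : AlgebraHom D E) (g : AlgebraHom B D) (f : AlgebraHom A B) :
  comp_alg h (comp_alg g f) = comp_alg (comp_alg h g) f.
Proof. by apply: AlgebraHom_eq; apply: mcompA. Qed.

Definition AlgebraCat : Category :=
  {| Ob := Algebra; Hom := AlgebraHom; idm := id_alg; mcomp := comp_alg;
     mcomp1m := comp1_alg; mcompm1 := comp_alg1; mcompA := comp_algA |}.
End EilenbergMoore.

Section Comparison.
Variables (C D : Category) (F : Functor C D) (U : Functor D C).
Variable adj : Adjunction F U.

Local Notation T := (comp_functor U F).

Lemma adj_mu_naturality (x y : C) (f : Hom x y) :
  fmap U (adj_counit adj (F y)) ∘ fmap (comp_functor T T) f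
  = fmap T f ∘ fmap U (adj_counit adj (F x)).
Proof.
rewrite /= -!fmapM; congr (fmap U _).
exact: (naturality (adj_counit adj) (fmap F f)).
Qed.

Definition adj_mu : NatTrans (comp_functor T T) T :=
  {| component := (fun x => fmap U (adj_counit adj (F x)))
       : forall x : C, Hom (comp_functor T T x) (T x);
     naturality := adj_mu_naturality |}.

Lemma adj_mu_etal (x : C) : adj_mu x ∘ adj_unit adj (T x) = idm (T x).
Proof. exact: (triangleU adj (F x)). Qed.

Lemma adj_mu_etar (x : C) : adj_mu x ∘ fmap T (adj_unit adj x) = idm (T x).
Proof. by rewrite /= -fmapM triangleF fmap1. Qed.

Lemma adj_muA (x : C) : adj_mu x ∘ fmap T (adj_mu x) = adj_mu x ∘ adj_mu (T x).
Proof.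
rewrite /= -!fmapM; congr (fmap U _).
exact: (naturality (adj_counit adj) (adj_counit adj (F x))).
Qed.

Definition adj_monad : Monad C :=
  {| mfun := T; eta := adj_unit adj; mu := adj_mu;
     mu_etal := adj_mu_etal; mu_etar := adj_mu_etar; muA := adj_muA |}.

Lemma comparison_mu (d : D) :
  fmap U (adj_counit adj d) ∘ mu adj_monad (U d)
  = fmap U (adj_counit adj d) ∘ fmap adj_monad (fmap U (adj_counit adj d)).
Proof.
rewrite /= -!fmapM; congr (fmap U _).
exact: esym (naturality (adj_counit adj) (adj_counit adj d)).
Qed.

Definition comparison_obj (d : D) : Algebra adj_monad :=
  @Build_Algebra C adj_monad (U d) (fmap U (adj_counit adj d))
    (triangleU adj d) (comparison_mu d).

Lemma comparison_morP (d e : D) (f : Hom d e) :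
  fmap U f ∘ action (comparison_obj d)
  = action (comparison_obj e) ∘ fmap adj_monad (fmap U f).
Proof.
rewrite /= -!fmapM; congr (fmap U _).
exact: esym (naturality (adj_counit adj) f).
Qed.

Definition comparison_mor (d e : D) (f : Hom d e) :
    AlgebraHom (comparison_obj d) (comparison_obj e) :=
  {| alg_mor := fmap U f : Hom (carrier (comparison_obj d))
                               (carrier (comparison_obj e));
     alg_morP := comparison_morP f |}.

Lemma comparison_mor1 (d : D) :
  comparison_mor (idm d) = id_alg (comparison_obj d).
Proof. by apply: AlgebraHom_eq; apply: fmap1. Qed.

Lemma comparison_morM (d e k : D) (g : Hom e k) (f : Hom d e) :
  comparison_mor (g ∘ f) = comp_alg (comparison_mor g) (comparison_mor f).
Proof. by apply: AlgebraHom_eq; apply: fmapM. Qed.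

Definition comparison : Functor D (AlgebraCat adj_monad) :=
  {| fobj := comparison_obj : D -> AlgebraCat adj_monad; fmap := comparison_mor;
     fmap1 := comparison_mor1; fmapM := comparison_morM |}.
End Comparison.

Definition monadic (C D : Category) (U : Functor D C) : Prop :=
  exists (F : Functor C D) (adj : Adjunction F U),
    is_equivalence (comparison adj).

Definition cast (ob : Type) (hom : ob -> ob -> Sets) (a a' b b' : ob)
    (ea : a = a') (eb : b = b') (f : hom a b) : hom a' b' :=
  eq_rect b (hom a') (eq_rect a (fun x => hom x b) f a' ea) b' eb.

(* In a strict monoidal category the objects form a monoid.  That monoid is the
   parameter here; strictness on morphisms compares morphisms whose sources
   (and targets) are only provably equal objects, hence the casts. *)
Record StrictSymMonCat (ob : Type) (I : ob) (ot : ob -> ob -> ob)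
    (otA : associative ot) (ot1l : left_id I ot) (ot1r : right_id I ot) := {
  hom : ob -> ob -> Sets;
  sid : forall a, hom a a;
  scomp : forall a b c, hom b c -> hom a b -> hom a c;
  stens : forall a b a' b', hom a b -> hom a' b' -> hom (ot a a') (ot b b');
  sbraid : forall a b, hom (ot a b) (ot b a);

  scomp1m : forall a b (f : hom a b), scomp (sid b) f = f;
  scompm1 : forall a b (f : hom a b), scomp f (sid a) = f;
  scompA : forall a b c d (h : hom c d) (g : hom b c) (f : hom a b),
    scomp h (scomp g f) = scomp (scomp h g) f;

  stens1 : forall a b, stens (sid a) (sid b) = sid (ot a b);
  stensM : forall a b c a' b' c' (g : hom b c) (f : hom a b)
                  (g' : hom b' c') (f' : hom a' b'),
    stens (scomp g f) (scomp g' f') = scomp (stens g g') (stens f f');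

  stensA : forall a b a' b' a'' b''
                  (f : hom a b) (f' : hom a' b') (f'' : hom a'' b''),
    cast (otA a a' a'') (otA b b' b'') (stens f (stens f' f''))
    = stens (stens f f') f'';
  stens1l : forall a b (f : hom a b),
    cast (ot1l a) (ot1l b) (stens (sid I) f) = f;
  stens1r : forall a b (f : hom a b),
    cast (ot1r a) (ot1r b) (stens f (sid I)) = f;

  sbraid_nat : forall a b a' b' (f : hom a b) (f' : hom a' b'),
    scomp (sbraid b b') (stens f f') = scomp (stens f' f) (sbraid a a');
  sbraidK : forall a b, scomp (sbraid b a) (sbraid a b) = sid (ot a b);
  sbraid_unit : forall a, cast (ot1r a) (ot1l a) (sbraid a I) = sid a;
  (* the hexagon axiom, with identity associators *)
  sbraid_tens : forall a b c,
    sbraid a (ot b c)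
    = scomp (cast erefl (otA b c a) (stens (sid b) (sbraid a c)))
            (cast (esym (otA a b c)) (esym (otA b a c))
               (stens (sbraid a b) (sid c)))
}.
Arguments hom {ob I ot otA ot1l ot1r} _ _ _.
Arguments sid {ob I ot otA ot1l ot1r} _ _.
Arguments scomp {ob I ot otA ot1l ot1r} _ {a b c} _ _.
Arguments stens {ob I ot otA ot1l ot1r} _ {a b a' b'} _ _.
Arguments sbraid {ob I ot otA ot1l ot1r} _ _ _.

(* The object part is the identity and hence omitted; preservation of the
   tensor product and unit on objects then holds definitionally. *)
Record StrictSymMonIdFunctor (ob : Type) (I : ob) (ot : ob -> ob -> ob)
    (otA : associative ot) (ot1l : left_id I ot) (ot1r : right_id I ot)
    (S T : StrictSymMonCat otA ot1l ot1r) := {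
  smap :> forall a b, hom S a b -> hom T a b;
  smap1 : forall a, smap (sid S a) = sid T a;
  smapM : forall a b c (g : hom S b c) (f : hom S a b),
    smap (scomp S g f) = scomp T (smap g) (smap f);
  smap_tens : forall a b a' b' (f : hom S a b) (f' : hom S a' b'),
    smap (stens S f f') = stens T (smap f) (smap f');
  smap_braid : forall a b, smap (sbraid S a b) = sbraid T a b
}.

Definition prop : Type := StrictSymMonCat addnA add0n addn0.
Definition prop_mor (S T : prop) : Type := StrictSymMonIdFunctor S T.

Section PropCategory.

Lemma prop_mor_eq (S T : prop) (f g : prop_mor S T) :
  (forall m n (x : hom S m n), f m n x = g m n x) -> f = g.
Proof.
case: f g => [f f1 fM ft fb] [g g1 gM gt gb] /= fg.
have efg : f = g.
  apply: functional_extensionality_dep => m.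
  apply: functional_extensionality_dep => n.
  exact: functional_extensionality.
case: _ / efg g1 gM gt gb => *.
by congr Build_StrictSymMonIdFunctor; apply: proof_irrelevance.
Qed.

Definition prop_id (S : prop) : prop_mor S S :=
  {| smap := fun _ _ x => x; smap1 := fun _ => erefl;
     smapM := fun _ _ _ _ _ => erefl; smap_tens := fun _ _ _ _ _ _ => erefl;
     smap_braid := fun _ _ => erefl |}.

Section Comp.
Variables (S T V : prop) (g : prop_mor T V) (f : prop_mor S T).

Local Notation gf := (fun m n (x : hom S m n) => g m n (f m n x)).

Lemma prop_comp1 m : gf _ _ (sid S m) = sid V m.
Proof. by rewrite /= !smap1. Qed.

Lemma prop_compM m n p (y : hom S n p) (x : hom S m n) :
  gf _ _ (scomp S y x) = scomp V (gf _ _ y) (gf _ _ x).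
Proof. by rewrite /= !smapM. Qed.

Lemma prop_comp_tens m n m' n' (x : hom S m n) (x' : hom S m' n') :
  gf _ _ (stens S x x') = stens V (gf _ _ x) (gf _ _ x').
Proof. by rewrite /= !smap_tens. Qed.

Lemma prop_comp_braid m n : gf _ _ (sbraid S m n) = sbraid V m n.
Proof. by rewrite /= !smap_braid. Qed.

Definition prop_comp : prop_mor S V :=
  {| smap := gf; smap1 := prop_comp1; smapM := prop_compM;
     smap_tens := prop_comp_tens; smap_braid := prop_comp_braid |}.
End Comp.

Lemma prop_comp1m (S T : prop) (f : prop_mor S T) : prop_comp (prop_id T) f = f.
Proof. exact: prop_mor_eq. Qed.

Lemma prop_compm1 (S T : prop) (f : prop_mor S T) : prop_comp f (prop_id S) = f.
Proof. exact: prop_mor_eq. Qed.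

Lemma prop_compA (S T V W : prop)
    (h : prop_mor V W) (g : prop_mor T V) (f : prop_mor S T) :
  prop_comp h (prop_comp g f) = prop_comp (prop_comp h g) f.
Proof. exact: prop_mor_eq. Qed.

Definition PROP : Category :=
  {| Ob := prop; Hom := prop_mor; idm := prop_id; mcomp := prop_comp;
     mcomp1m := prop_comp1m; mcompm1 := prop_compm1; mcompA := prop_compA |}.
End PropCategory.

Definition SigCat : Category := FunctorCat (Discrete (nat * nat)) SetCat.

Section Forgetful.

(* The only morphisms of the discrete category are identities, so the action
   on morphisms is forced to be transport. *)
Definition sig_fmap (T : prop) (p q : nat * nat) (e : p = q) :
    hom T p.1 p.2 -> hom T q.1 q.2 :=
  eq_rect p (fun r => hom T p.1 p.2 -> hom T r.1 r.2) (fun x => x) q e.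
Arguments sig_fmap T {p q} e _.

Lemma sig_fmapM (T : prop) (p q r : nat * nat) (e' : q = r) (e : p = q) :
  sig_fmap T (etrans e e') = (fun x => sig_fmap T e' (sig_fmap T e x)).
Proof. by case: _ / e'; case: _ / e. Qed.

Definition underlying_sig (T : prop) : SigCat :=
  @Build_Functor (Discrete (nat * nat)) SetCat
    (fun p => hom T p.1 p.2) (@sig_fmap T) (fun _ => erefl) (@sig_fmapM T).

Lemma underlying_naturality (S T : prop) (f : prop_mor S T)
    (p q : nat * nat) (e : p = q) :
  (fun x => f q.1 q.2 (sig_fmap S e x)) = (fun x => sig_fmap T e (f p.1 p.2 x)).
Proof. by case: _ / e. Qed.

Definition underlying_mor (S T : prop) (f : prop_mor S T) :
    Hom (underlying_sig S) (underlying_sig T) :=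
  @Build_NatTrans _ _ (underlying_sig S) (underlying_sig T)
    (fun p => f p.1 p.2) (underlying_naturality f).

Lemma underlying_mor1 (S : prop) :
  underlying_mor (prop_id S) = idm (underlying_sig S).
Proof. exact: NatTrans_eq. Qed.

Lemma underlying_morM (S T V : prop) (g : prop_mor T V) (f : prop_mor S T) :
  underlying_mor (prop_comp g f) = underlying_mor g ∘ underlying_mor f.
Proof. exact: NatTrans_eq. Qed.

Definition forgetful : Functor PROP SigCat :=
  @Build_Functor PROP SigCat underlying_sig underlying_mor
    underlying_mor1 underlying_morM.
End Forgetful.

(* Main.v *)
Require Import Defs.
From mathcomp Require Import all_boot.
From Stdlib Require Import FunctionalExtensionality PropExtensionality.
From Stdlib Require Import ProofIrrelevance ClassicalEpsilon.

(** Props are the models of a many-sorted equational theory whose sorts are the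
pairs (m, n); monadicity is Birkhoff's theory of such models, and it splits
into two independent facts.

The forgetful functor has a left adjoint.  The free prop on a signature X
consists of the formal terms built from X by the prop operations, two terms
being identified when they take the same value in every prop under every
interpretation of X.  Quantifying over all props replaces a generated
congruence: the values separate the classes by definition, so the quotient
inherits the laws of props ([prop_of_separating]), and
evaluation is the universal property ([free_lift_gen], [free_prop_ext]).

Every left adjoint F of the forgetful functor U is monadic
([comparison_equivalence]).  Let a : UF(A) -> A be an algebra.  An operation
is defined on A by applying it to generators in F(A) and then applying a.  The
associativity law of the algebra says exactly that a commutes with these
operations ([action_morphism]), and its unit law makes a surjective; hence A
inherits the equations of F(A) ([prop_of_quotient]) and is a prop.  The
comparison functor and this construction are mutually inverse, the
isomorphisms being identities on underlying elements. *)

Set Implicit Arguments.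
Unset Strict Implicit.
Unset Printing Implicit Defensive.

(** * Families of maps and discrete categories *)

Lemma map_cast (h k : nat -> nat -> Sets) (phi : forall m n, h m n -> k m n)
    m m' n n' (em : m = m') (en : n = n') (x : h m n) :
  phi m' n' (cast em en x) = cast em en (phi m n x).
Proof. by case: _ / em; case: _ / en. Qed.

Lemma discrete_naturality (T : Type) (D : Category)
    (F G : Functor (Discrete T) D) (c : forall x : T, Hom (F x) (G x))
    (x y : Discrete T) (e : Hom x y) :
  c y ∘ fmap F e = fmap G e ∘ c x.
Proof.
case: _ / e; rewrite (fmap1 F x) (fmap1 G x).
by rewrite mcomp1m mcompm1.
Qed.

Definition discrete_nat (T : Type) (D : Category)
    (F G : Functor (Discrete T) D) (c : forall x : T, Hom (F x) (G x)) :
    NatTrans F G :=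
  {| component := c : forall x : Discrete T, Hom (F x) (G x);
     naturality := discrete_naturality c |}.

Lemma sig_eq_at (X Y : SigCat) (a b : Hom X Y) :
  a = b ->
  forall p (x : X p),
    component (a : NatTrans X Y) p x = component (b : NatTrans X Y) p x.
Proof. by case: _ /. Qed.

(** * Adjunctions from universal arrows *)

Section UniversalArrows.
Variables (C D : Category) (U : Functor D C).
Variables (F : C -> D) (unit : forall x, Hom x (U (F x))).
Variable lift : forall (x : C) (d : D), Hom x (U d) -> Hom (F x) d.
Hypothesis lift_unit : forall (x : C) (d : D) (f : Hom x (U d)),
  fmap U (lift f) ∘ unit x = f.
Hypothesis lift_unique : forall (x : C) (d : D) (g h : Hom (F x) d),
  fmap U g ∘ unit x = fmap U h ∘ unit x -> g = h.

Let Fmap (x y : C) (f : Hom x y) : Hom (F x) (F y) := lift (unit y ∘ f).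

Lemma universal_fmap1 (x : C) : Fmap (idm x) = idm (F x).
Proof. by apply: lift_unique; rewrite lift_unit fmap1 mcomp1m mcompm1. Qed.

Lemma universal_fmapM (x y z : C) (g : Hom y z) (f : Hom x y) :
  Fmap (g ∘ f) = Fmap g ∘ Fmap f.
Proof.
by apply: lift_unique; rewrite fmapM -mcompA !lift_unit !mcompA lift_unit.
Qed.

Definition universal_functor : Functor C D :=
  {| fobj := F; fmap := Fmap; fmap1 := universal_fmap1;
     fmapM := universal_fmapM |}.

Lemma universal_unit_naturality (x y : C) (f : Hom x y) :
  unit y ∘ f = fmap (comp_functor U universal_functor) f ∘ unit x.
Proof. by rewrite /= lift_unit. Qed.

Lemma universal_counit_naturality (d e : D) (f : Hom d e) :
  lift (idm (U e)) ∘ fmap (comp_functor universal_functor U) f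
  = f ∘ lift (idm (U d)).
Proof.
apply: lift_unique; rewrite /= !fmapM -!mcompA !lift_unit.
by rewrite mcompA lift_unit mcomp1m mcompm1.
Qed.

Definition universal_unit :
    NatTrans (id_functor C) (comp_functor U universal_functor) :=
  {| component := unit
       : forall x, Hom (id_functor C x) (comp_functor U universal_functor x);
     naturality := universal_unit_naturality |}.

Definition universal_counit :
    NatTrans (comp_functor universal_functor U) (id_functor D) :=
  {| component := (fun d => lift (idm (U d)))
       : forall d, Hom (comp_functor universal_functor U d) (id_functor D d);
     naturality := universal_counit_naturality |}.

Lemma universal_triangleF (x : C) :
  universal_counit (universal_functor x) ∘ fmap universal_functor
    (universal_unit x) = idm (universal_functor x).
Proof.
apply: lift_unique.
by rewrite /= fmapM -mcompA lift_unit mcompA lift_unit fmap1.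
Qed.

Lemma universal_triangleU (d : D) :
  fmap U (universal_counit d) ∘ universal_unit (U d) = idm (U d).
Proof. exact: lift_unit. Qed.

Definition universal_adjunction : Adjunction universal_functor U :=
  {| adj_unit := universal_unit; adj_counit := universal_counit;
     triangleF := universal_triangleF; triangleU := universal_triangleU |}.
End UniversalArrows.

Lemma adjunct_expansion (C D : Category) (F : Functor C D) (U : Functor D C)
    (adj : Adjunction F U) (x : C) (d : D) (f : Hom (F x) d) :
  f = adj_counit adj d ∘ fmap F (fmap U f ∘ adj_unit adj x).
Proof.
rewrite fmapM mcompA.
rewrite (naturality (adj_counit adj) f : _ ∘ fmap F (fmap U f) = _).
by rewrite -mcompA triangleF mcompm1.
Qed.

Lemma algebra_iso (C : Category) (T : Monad C) (A B : AlgebraCat T)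
    (f : Hom A B) :
  is_iso (alg_mor f) -> is_iso f.
Proof.
case=> g [gf fg].
have gP : g ∘ action B = action A ∘ fmap T g.
  rewrite -[LHS]mcompm1 -fmap1 -fg fmapM mcompA -(mcompA g) -alg_morP.
  by rewrite (mcompA g) gf mcomp1m.
by exists (Build_AlgebraHom gP); split; apply: AlgebraHom_eq.
Qed.

(** * Operations of props and inheritance of their laws *)

Record prop_ops := {
  ohom :> nat -> nat -> Sets;
  oid : forall m, ohom m m;
  ocomp : forall m n p, ohom n p -> ohom m n -> ohom m p;
  otens : forall m n m' n', ohom m n -> ohom m' n' -> ohom (m + m') (n + n');
  obraid : forall m n, ohom (m + n) (n + m)
}.
Arguments ocomp O {m n p} _ _ : rename.
Arguments otens O {m n m' n'} _ _ : rename.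

Definition ops_of (S : prop) : prop_ops :=
  {| ohom := hom S; oid := sid S; ocomp := @scomp _ _ _ _ _ _ S;
     otens := @stens _ _ _ _ _ _ S; obraid := sbraid S |}.

Record preserves_ops (O P : prop_ops) (phi : forall m n, O m n -> P m n) :
    Prop := {
  map_id : forall m, phi _ _ (oid O m) = oid P m;
  map_comp : forall m n p (y : O n p) (x : O m n),
    phi _ _ (ocomp O y x) = ocomp P (phi _ _ y) (phi _ _ x);
  map_tens : forall m n m' n' (x : O m n) (y : O m' n'),
    phi _ _ (otens O x y) = otens P (phi _ _ x) (phi _ _ y);
  map_braid : forall m n, phi _ _ (obraid O m n) = obraid P m n
}.

Definition mor_of_preserves (S T : prop)
    (phi : forall m n, hom S m n -> hom T m n)
    (H : @preserves_ops (ops_of S) (ops_of T) phi) : prop_mor S T :=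
  @Build_StrictSymMonIdFunctor _ _ _ _ _ _ S T phi
    (map_id H) (map_comp H) (map_tens H) (map_braid H).

(** Equational laws pass to subobjects of products.  The product of the [S i]
is never formed, because the index type may be too large for it. *)
Section Separating.
Variables (O : prop_ops) (I : Type) (S : I -> prop).
Variable phi : forall i m n, O m n -> hom (S i) m n.
Hypothesis phiP : forall i, @preserves_ops O (ops_of (S i)) (phi i).
Hypothesis phi_inj : forall m n (x y : O m n),
  (forall i, phi i x = phi i y) -> x = y.

Definition prop_of_separating : prop.
Proof.
refine (@Build_StrictSymMonCat nat 0 addn addnA add0n addn0
  O (oid O) (@ocomp O) (@otens O) (obraid O) _ _ _ _ _ _ _ _ _ _ _ _);
  move=> *; apply: phi_inj => i;
  rewrite !(map_id (phiP i), map_comp (phiP i), map_tens (phiP i),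
            map_braid (phiP i), map_cast (phi i)) /=.
- exact: scomp1m.
- exact: scompm1.
- exact: scompA.
- exact: stens1.
- exact: stensM.
- exact: stensA.
- exact: stens1l.
- exact: stens1r.
- exact: sbraid_nat.
- exact: sbraidK.
- exact: sbraid_unit.
- exact: sbraid_tens.
Defined.
End Separating.

(** Equational laws pass to quotients.  A chosen section [psi] expresses
surjectivity. *)
Section Quotient.
Variables (S : prop) (O : prop_ops) (phi : forall m n, hom S m n -> O m n).
Hypothesis phiP : @preserves_ops (ops_of S) O phi.
Variable psi : forall m n, O m n -> hom S m n.
Hypothesis psiK : forall m n (x : O m n), phi (psi x) = x.

Lemma quotient_ind m n (P : O m n -> Prop) :
  (forall s : hom S m n, P (phi s)) -> forall x, P x.
Proof. by move=> HP x; rewrite -(psiK x). Qed.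

Definition prop_of_quotient : prop.
Proof.
refine (@Build_StrictSymMonCat nat 0 addn addnA add0n addn0
  O (oid O) (@ocomp O) (@otens O) (obraid O) _ _ _ _ _ _ _ _ _ _ _ _);
  have E := (map_id phiP, map_comp phiP, map_tens phiP, map_braid phiP,
             map_cast phi).
- by move=> a b; apply: quotient_ind => f; rewrite -!E /= scomp1m.
- by move=> a b; apply: quotient_ind => f; rewrite -!E /= scompm1.
- move=> a b c d; apply: quotient_ind => h; apply: quotient_ind => g.
  by apply: quotient_ind => f; rewrite -!E /= scompA.
- by move=> a b; rewrite -!E /= stens1.
- move=> a b c a' b' c'; apply: quotient_ind => g; apply: quotient_ind => f.
  apply: quotient_ind => g'; apply: quotient_ind => f'.
  by rewrite -!E /= stensM.
- move=> a b a' b' a'' b''; apply: quotient_ind => f; apply: quotient_ind => g.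
  by apply: quotient_ind => h; rewrite -!E /= stensA.
- by move=> a b; apply: quotient_ind => f; rewrite -!E /= stens1l.
- by move=> a b; apply: quotient_ind => f; rewrite -!E /= stens1r.
- move=> a b a' b'; apply: quotient_ind => f; apply: quotient_ind => g.
  by rewrite -!E /= sbraid_nat.
- by move=> a b; rewrite -!E /= sbraidK.
- by move=> a; rewrite -!E /= sbraid_unit.
- by move=> a b c; rewrite -!E /= sbraid_tens.
Defined.
End Quotient.

(** * The free prop on a signature *)

Section FreeProp.
Variable X : SigCat.

(** Generators are indexed by a pair p rather than by m and n, so that an
interpretation has exactly the shape of the components of a natural
transformation from X to an underlying signature. *)
Inductive term : nat -> nat -> Type :=
| Gen (p : nat * nat) of (X p : Sets) : term p.1 p.2
| Id m : term m m
| Comp m n p of term n p & term m n : term m p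
| Tens m n m' n' of term m n & term m' n' : term (m + m') (n + n')
| Braid m n : term (m + n) (n + m).

Fixpoint eval (S : prop) (f : forall p, X p -> hom S p.1 p.2) m n
    (t : term m n) : hom S m n :=
  match t with
  | Gen p x => f p x
  | Id m => sid S m
  | Comp _ _ _ u t => scomp S (eval f u) (eval f t)
  | Tens _ _ _ _ t u => stens S (eval f t) (eval f u)
  | Braid m n => sbraid S m n
  end.

Definition interpretation := {S : prop & forall p, X p -> hom S p.1 p.2}.

Definition term_equiv m n (t u : term m n) : Prop :=
  forall i : interpretation, eval (projT2 i) t = eval (projT2 i) u.

(** The quotient by [term_equiv] is realised as the set of chosen
representatives. *)
Definition normal m n (t : term m n) : term m n :=
  epsilon (inhabits t) (term_equiv t).

Lemma normal_equiv m n (t : term m n) : term_equiv t (normal t).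
Proof. by apply: epsilon_spec; exists t. Qed.

Lemma normal_eq m n (t u : term m n) : term_equiv t u -> normal t = normal u.
Proof.
move=> tu; rewrite /normal (_ : term_equiv t = term_equiv u).
  by congr epsilon; apply: proof_irrelevance.
apply: functional_extensionality => v; apply: propositional_extensionality.
by split=> tv i; rewrite -tv tu.
Qed.

Definition free_hom m n : Sets := {t : term m n | normal t = t}.

Lemma normalK m n (t : term m n) : normal (normal t) = normal t.
Proof. by apply: normal_eq => i; rewrite -normal_equiv. Qed.

Definition cl m n (t : term m n) : free_hom m n :=
  exist _ (normal t) (normalK t).

Lemma free_hom_eq m n (x y : free_hom m n) :
  term_equiv (sval x) (sval y) -> x = y.
Proof.
case: x y => [t tK] [u uK] /= /normal_eq; rewrite tK uK => tu.
by case: _ / tu uK => uK; congr exist; apply: proof_irrelevance.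
Qed.

Lemma cl_eq m n (t u : term m n) : term_equiv t u -> cl t = cl u.
Proof. by move=> tu; apply: free_hom_eq => i /=; rewrite -!normal_equiv. Qed.

Lemma cl_sval m n (x : free_hom m n) : cl (sval x) = x.
Proof. by apply: free_hom_eq => i /=; rewrite -normal_equiv. Qed.

Definition free_ops : prop_ops :=
  {| ohom := free_hom; oid := fun m => cl (Id m);
     ocomp := fun _ _ _ y x => cl (Comp (sval y) (sval x));
     otens := fun _ _ _ _ x y => cl (Tens (sval x) (sval y));
     obraid := fun m n => cl (Braid m n) |}.

Lemma eval_preserves (i : interpretation) :
  @preserves_ops free_ops (ops_of (projT1 i))
    (fun m n x => eval (projT2 i) (sval x)).
Proof. by split=> * /=; rewrite -normal_equiv. Qed.

Definition free_prop : prop := prop_of_separating eval_preserves free_hom_eq.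

Definition free_gen (p : nat * nat) (x : X p) : hom free_prop p.1 p.2 :=
  cl (Gen x).

Lemma cl_comp m n p (u : term n p) (t : term m n) :
  cl (Comp u t) = scomp free_prop (cl u) (cl t).
Proof. by apply: cl_eq => i /=; rewrite -!normal_equiv. Qed.

Lemma cl_tens m n m' n' (t : term m n) (u : term m' n') :
  cl (Tens t u) = stens free_prop (cl t) (cl u).
Proof. by apply: cl_eq => i /=; rewrite -!normal_equiv. Qed.

Definition free_lift (S : prop) (f : forall p, X p -> hom S p.1 p.2) :
    prop_mor free_prop S :=
  @mor_of_preserves free_prop S _
    (eval_preserves (existT (fun S => forall p, X p -> hom S p.1 p.2) S f)).

Lemma free_lift_gen (S : prop) (f : forall p, X p -> hom S p.1 p.2)
    p (x : X p) :
  free_lift f _ _ (free_gen x) = f p x.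
Proof. by rewrite /= -(normal_equiv (Gen x) (existT _ S f)).
Qed.

(** Every element is the class of a term, and taking classes turns the term
constructors into the operations, so induction on terms applies. *)
Lemma free_prop_ext (S : prop) (g h : prop_mor free_prop S) :
  (forall p (x : X p), g _ _ (free_gen x) = h _ _ (free_gen x)) -> g = h.
Proof.
move=> gh; apply: prop_mor_eq => m n x; rewrite -(cl_sval x).
elim: {x}(sval x) =>
  {m n} [p x | m | m n p u IHu t IHt | m n m' n' t IHt u IHu | m n].
- exact: gh.
- exact: etrans (smap1 g m) (esym (smap1 h m)).
- by rewrite cl_comp !smapM IHu IHt.
- by rewrite cl_tens !smap_tens IHt IHu.
- exact: etrans (smap_braid g m n) (esym (smap_braid h m n)).
Qed.

Definition free_unit : Hom X (forgetful free_prop) :=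
  @discrete_nat _ SetCat X (underlying_sig free_prop) free_gen.

Lemma free_lift_unit (S : PROP) (f : Hom X (forgetful S)) :
  fmap forgetful (free_lift f : @Hom PROP free_prop S) ∘ free_unit = f.
Proof.
apply: NatTrans_eq => p; apply: functional_extensionality => x.
exact: free_lift_gen.
Qed.

Lemma free_lift_unique (S : PROP) (g h : @Hom PROP free_prop S) :
  fmap forgetful g ∘ free_unit = fmap forgetful h ∘ free_unit -> g = h.
Proof.
move=> gh; apply: free_prop_ext => p x.
exact: (sig_eq_at gh x).
Qed.
End FreeProp.

(** * The comparison functor is an equivalence *)

Section Comparison.
Variables (F : Functor SigCat PROP) (adj : Adjunction F forgetful).

Section AlgebraProp.
Variable A : Algebra (adj_monad adj).

Let sig : SigCat := carrier A.
Let act m n : hom (F sig) m n -> sig (m, n) := action A (m, n).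
Let unit m n : sig (m, n) -> hom (F sig) m n := adj_unit adj sig (m, n).

Definition algebra_ops : prop_ops :=
  {| ohom := fun m n => sig (m, n);
     oid := fun m => act (sid (F sig) m);
     ocomp := fun _ _ _ y x => act (scomp (F sig) (unit y) (unit x));
     otens := fun _ _ _ _ x y => act (stens (F sig) (unit x) (unit y));
     obraid := fun m n => act (sbraid (F sig) m n) |}.

Let unit2 m n : hom (F sig) m n -> hom (F (underlying_sig (F sig))) m n :=
  adj_unit adj (underlying_sig (F sig)) (m, n).

Lemma action_unit m n (x : algebra_ops m n) : act (unit x) = x.
Proof. exact: (sig_eq_at (action_eta A) (p := (m, n)) x). Qed.

(* The two maps F(UF(A)) -> F(A) that the associativity law compares. *)
Let flatten : prop_mor (F (underlying_sig (F sig))) (F sig) :=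
  adj_counit adj (F sig).
Let evaluate : prop_mor (F (underlying_sig (F sig))) (F sig) :=
  fmap F (action A).

Lemma flatten_unit2 m n (s : hom (F sig) m n) : flatten _ _ (unit2 s) = s.
Proof.
exact: (sig_eq_at (triangleU adj (F sig)) (p := (m, n)) s).
Qed.

Lemma evaluate_unit2 m n (s : hom (F sig) m n) :
  evaluate _ _ (unit2 s) = unit (act s).
Proof.
exact: (sig_eq_at (esym (naturality (adj_unit adj) (action A)))
  (p := (m, n)) s).
Qed.

(** The associativity law of the algebra, read on elements. *)
Lemma action_flatten m n (w : hom (F (underlying_sig (F sig))) m n) :
  act (flatten _ _ w) = act (evaluate _ _ w).
Proof. exact: (sig_eq_at (action_mu A) (p := (m, n)) w). Qed.

(** An operation applied to elements of F(A) is the flattening of the same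
operation applied to generators of F(UF(A)); evaluating those generators
instead gives the operation of A. *)
Lemma action_morphism : @preserves_ops (ops_of (F sig)) algebra_ops act.
Proof.
split=> //= [m n p y x | m n m' n' x y].
- have := action_flatten (scomp _ (unit2 y) (unit2 x)).
  by rewrite !smapM !flatten_unit2 !evaluate_unit2.
- have := action_flatten (stens _ (unit2 x) (unit2 y)).
  by rewrite !smap_tens !flatten_unit2 !evaluate_unit2.
Qed.

Definition algebra_prop : prop := prop_of_quotient action_morphism action_unit.
End AlgebraProp.

Section AlgebraMor.
Variables (A B : Algebra (adj_monad adj)) (h : AlgebraHom A B).

Let h_ m n : algebra_ops A m n -> algebra_ops B m n := alg_mor h (m, n).
Let Fh : prop_mor (F (carrier A)) (F (carrier B)) := fmap F (alg_mor h).

Lemma alg_mor_action m n (s : hom (F (carrier A)) m n) :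
  h_ (action A (m, n) s) = action B (m, n) (Fh _ _ s).
Proof. exact: (sig_eq_at (alg_morP h) (p := (m, n)) s). Qed.

Lemma alg_mor_unit m n (x : carrier A (m, n)) :
  Fh _ _ (adj_unit adj (carrier A) (m, n) x)
  = adj_unit adj (carrier B) (m, n) (h_ x).
Proof.
exact: (sig_eq_at (esym (naturality (adj_unit adj) (alg_mor h)))
  (p := (m, n)) x).
Qed.

(** A morphism of algebras commutes with the actions, and units are natural;
the operations of an algebra are made of these two maps and of operations of
free props. *)
Lemma alg_mor_preserves : @preserves_ops (algebra_ops A) (algebra_ops B) h_.
Proof.
split=> * /=; rewrite alg_mor_action.
- by rewrite smap1.
- by rewrite smapM !alg_mor_unit.
- by rewrite smap_tens !alg_mor_unit.
- by rewrite smap_braid.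
Qed.

Definition algebra_prop_mor : prop_mor (algebra_prop A) (algebra_prop B) :=
  @mor_of_preserves (algebra_prop A) (algebra_prop B) h_ alg_mor_preserves.
End AlgebraMor.

Definition algebra_to_prop : Functor (AlgebraCat (adj_monad adj)) PROP.
Proof.
refine (@Build_Functor (AlgebraCat (adj_monad adj)) PROP
  algebra_prop algebra_prop_mor _ _).
- by move=> A; apply: prop_mor_eq.
- by move=> A B D g f; apply: prop_mor_eq.
Defined.

(** The action of the algebra [comparison adj S] is the counit at S.  It is a
morphism of props and sends a generator to the element it stands for, so the
operations reconstructed from the action are those of S. *)
Lemma comparison_ops_preserves (S : prop) :
  let O := algebra_ops (comparison adj S) in
  @preserves_ops O (ops_of S) (fun m n x => x)
  /\ @preserves_ops (ops_of S) O (fun m n x => x).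
Proof.
have counit_unit m n (x : hom S m n) :
    (adj_counit adj S : prop_mor _ S) m n
      (adj_unit adj (underlying_sig S) (m, n) x) = x.
  exact: (sig_eq_at (triangleU adj S) (p := (m, n)) x).
have id_ m := smap1 (adj_counit adj S : prop_mor _ S) m.
have braid_ m n := smap_braid (adj_counit adj S : prop_mor _ S) m n.
split; split=> //= *.
- by rewrite smapM !counit_unit.
- by rewrite smap_tens !counit_unit.
- by rewrite smapM !counit_unit.
- by rewrite smap_tens !counit_unit.
Qed.

Definition prop_to_comparison (S : prop) :
    prop_mor S (algebra_prop (comparison adj S)) :=
  @mor_of_preserves S (algebra_prop (comparison adj S)) _
    (proj2 (comparison_ops_preserves S)).

Definition comparison_to_prop (S : prop) :
    prop_mor (algebra_prop (comparison adj S)) S :=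
  @mor_of_preserves (algebra_prop (comparison adj S)) S _
    (proj1 (comparison_ops_preserves S)).

Definition prop_unit :
    NatTrans (id_functor PROP) (comp_functor algebra_to_prop (comparison adj)).
Proof.
refine (@Build_NatTrans PROP PROP (id_functor PROP)
  (comp_functor algebra_to_prop (comparison adj)) prop_to_comparison _).
by move=> S T f; apply: prop_mor_eq.
Defined.

Section AlgebraIso.
Variable A : Algebra (adj_monad adj).

(** This is the identity: matching on p is there because p and (p.1, p.2) are
convertible only when p is a literal pair. *)
Definition carrier_map : Hom (underlying_sig (algebra_prop A)) (carrier A) :=
  @discrete_nat _ SetCat (underlying_sig (algebra_prop A)) (carrier A)
    (fun p => let: (m, n) := p
       return carrier A (p.1, p.2) -> carrier A p in id).

Definition carrier_map_inv :
    Hom (carrier A) (underlying_sig (algebra_prop A)) :=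
  @discrete_nat _ SetCat (carrier A) (underlying_sig (algebra_prop A))
    (fun p => let: (m, n) := p
       return carrier A p -> carrier A (p.1, p.2) in id).

Lemma carrier_map_iso : is_iso carrier_map.
Proof. by exists carrier_map_inv; split; apply: NatTrans_eq => -[m n]. Qed.

Definition action_mor : prop_mor (F (carrier A)) (algebra_prop A) :=
  @mor_of_preserves (F (carrier A)) (algebra_prop A) _ (action_morphism A).

(** Both sides are morphisms out of a free prop, so it is enough that they
agree on generators, where both are the identity. *)
Lemma counit_algebra_prop :
  adj_counit adj (algebra_prop A)
  = (action_mor : @Hom PROP (F (carrier A)) (algebra_prop A))
    ∘ fmap F carrier_map.
Proof.
rewrite [RHS](adjunct_expansion adj).
rewrite (_ : fmap forgetful _ ∘ _ = idm _) ?fmap1 ?mcompm1 //.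
apply: NatTrans_eq => -[m n]; apply: functional_extensionality => x.
have nat_x := sig_eq_at (naturality (adj_unit adj) carrier_map)
  (p := (m, n)) x.
exact: etrans (congr1 (action A (m, n)) (esym nat_x)) (action_unit x).
Qed.

Lemma carrier_map_alg :
  carrier_map ∘ action (comparison adj (algebra_prop A))
  = action A ∘ fmap (adj_monad adj) carrier_map.
Proof.
rewrite /= counit_algebra_prop.
by apply: NatTrans_eq => -[m n].
Qed.

Definition carrier_alg : AlgebraHom (comparison adj (algebra_prop A)) A :=
  Build_AlgebraHom carrier_map_alg.
End AlgebraIso.

Definition algebra_counit :
    NatTrans (comp_functor (comparison adj) algebra_to_prop)
      (id_functor (AlgebraCat (adj_monad adj))).
Proof.
refine (@Build_NatTrans (AlgebraCat (adj_monad adj)) _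
  (comp_functor (comparison adj) algebra_to_prop) (id_functor _) carrier_alg _).
by move=> A B h; apply: AlgebraHom_eq; apply: NatTrans_eq => -[m n].
Defined.

Lemma comparison_equivalence : is_equivalence (comparison adj).
Proof.
exists algebra_to_prop, prop_unit, algebra_counit; split=> [S | A].
- by exists (comparison_to_prop S); split; apply: prop_mor_eq.
- exact/algebra_iso/carrier_map_iso.
Qed.
End Comparison.

Theorem proposition5p2 : monadic forgetful.
Proof.
exists (universal_functor free_lift_unit free_lift_unique).
exists (universal_adjunction free_lift_unit free_lift_unique).
exact: comparison_equivalence.
Qed.
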